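(* $\mathsf{WF}_{b4}^s \implies \mathsf{CSB}^*$.
   Context: Work in $\mathsf{ZF}$. For sets $X,Y$: $|X|=|Y|$ means there is a bijection $X\to Y$; $|X|\leq^*|Y|$ means $X=\emptyset$ or $Y$ surjects onto $X$; $|X|=^*|Y|$ means $|X|\leq^*|Y|$ and $|Y|\leq^*|X|$. $\mathsf{WF}_{b4}^s$ is the statement: given an infinite sequence of sets $(A_i)$ and a corresponding sequence of surjections $f_i : A_i \to A_{i+1}$, there is some $n \in \mathbb{N}$ such that $|A_n| = |A_{n+1}|$. $\mathsf{CSB}^*$ (Dual Cantor–Schröder–Bernstein) is the statement: if $|X| =^* |Y|$ then $|X| = |Y|$. *)

(* Defs.v *)
(* "Work in ZF" is rendered semantically: the theorem is about an arbitrary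
   model (V, mem) of first-order ZF, and sets, functions, natural numbers and
   sequences are those of the model.  Cardinalities of Rocq types would not do,
   since Rocq's usual axioms make choice available for types.  For the same
   reason the two schemata range over first-order formulas with parameters and
   not over arbitrary predicates V -> Prop. *)

Set Implicit Arguments.

(* First-order formulas in the language of set theory, with de Bruijn
   indices as variables. *)
Inductive formula : Type :=
| fMem (i j : nat)
| fEq (i j : nat)
| fFalse
| fImp (p q : formula)
| fAnd (p q : formula)
| fOr (p q : formula)
| fAll (p : formula)
| fEx (p : formula).

Definition scons (V : Type) (x : V) (e : nat -> V) (n : nat) : V :=
  match n with
  | 0 => x
  | S k => e k
  end.

Section SetTheory.

Variables (V : Type) (mem : V -> V -> Prop).

Local Notation "x ∈ y" := (mem x y) (at level 70).

Fixpoint sat (e : nat -> V) (p : formula) : Prop :=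
  match p with
  | fMem i j => e i ∈ e j
  | fEq i j => e i = e j
  | fFalse => False
  | fImp p q => sat e p -> sat e q
  | fAnd p q => sat e p /\ sat e q
  | fOr p q => sat e p \/ sat e q
  | fAll p => forall x, sat (scons x e) p
  | fEx p => exists x, sat (scons x e) p
  end.

Definition is_empty (x : V) : Prop := forall z, ~ z ∈ x.

Definition subset (x y : V) : Prop := forall z, z ∈ x -> z ∈ y.

(* z = {a, b} *)
Definition is_upair (z a b : V) : Prop := forall x, x ∈ z <-> x = a \/ x = b.

(* p = (a, b) = {{a}, {a, b}} *)
Definition is_opair (p a b : V) : Prop :=
  forall z, z ∈ p <-> is_upair z a a \/ is_upair z a b.

(* s = x ∪ {x} *)
Definition is_succ (x s : V) : Prop := forall z, z ∈ s <-> z ∈ x \/ z = x.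

Definition inductive (w : V) : Prop :=
  (exists o, is_empty o /\ o ∈ w) /\
  (forall x, x ∈ w -> exists s, is_succ x s /\ s ∈ w).

Definition is_omega (w : V) : Prop :=
  inductive w /\ (forall v, inductive v -> subset w v).

Record ZF : Prop := {
  ZF_extensionality : forall x y, (forall z, z ∈ x <-> z ∈ y) -> x = y;
  ZF_foundation : forall x, (exists y, y ∈ x) ->
    exists y, y ∈ x /\ ~ (exists z, z ∈ x /\ z ∈ y);
  ZF_pairing : forall a b, exists z, is_upair z a b;
  ZF_union : forall x, exists u, forall z, z ∈ u <-> exists y, y ∈ x /\ z ∈ y;
  ZF_powerset : forall x, exists p, forall z, z ∈ p <-> subset z x;
  ZF_infinity : exists w, inductive w;
  ZF_separation : forall (phi : formula) (e : nat -> V) (a : V),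
    exists b, forall x, x ∈ b <-> x ∈ a /\ sat (scons x e) phi;
  ZF_replacement : forall (phi : formula) (e : nat -> V) (a : V),
    (forall x, x ∈ a -> exists! y, sat (scons x (scons y e)) phi) ->
    exists b, forall y,
      y ∈ b <-> exists x, x ∈ a /\ sat (scons x (scons y e)) phi
}.

(* (a, b) ∈ f *)
Definition maps (f a b : V) : Prop := exists p, is_opair p a b /\ p ∈ f.

(* f is a function with domain X (and unspecified codomain) *)
Definition is_function_on (f X : V) : Prop :=
  (forall p, p ∈ f -> exists a b, a ∈ X /\ is_opair p a b) /\
  (forall a, a ∈ X -> exists! b, maps f a b).

Definition is_function (f X Y : V) : Prop :=
  is_function_on f X /\ (forall a b, maps f a b -> b ∈ Y).

Definition is_surjection (f X Y : V) : Prop :=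
  is_function f X Y /\ (forall y, y ∈ Y -> exists x, x ∈ X /\ maps f x y).

Definition is_injection (f X Y : V) : Prop :=
  is_function f X Y /\ (forall x x' y, maps f x y -> maps f x' y -> x = x').

Definition is_bijection (f X Y : V) : Prop :=
  is_injection f X Y /\ is_surjection f X Y.

(* |X| = |Y| *)
Definition card_eq (X Y : V) : Prop := exists f, is_bijection f X Y.

(* |X| <=* |Y| *)
Definition card_le_star (X Y : V) : Prop :=
  is_empty X \/ exists f, is_surjection f Y X.

(* |X| =* |Y| *)
Definition card_eq_star (X Y : V) : Prop :=
  card_le_star X Y /\ card_le_star Y X.

(* Both sequences are sets of the model: functions A : i |-> A_i and
   F : i |-> f_i whose domain is the ω of the model. *)
Definition WF_b4_s : Prop :=
  forall w A F : V,
    is_omega w ->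
    is_function_on A w ->
    is_function_on F w ->
    (forall i j Ai Aj fi, i ∈ w -> is_succ i j ->
       maps A i Ai -> maps A j Aj -> maps F i fi -> is_surjection fi Ai Aj) ->
    exists n m An Am, n ∈ w /\ is_succ n m /\
      maps A n An /\ maps A m Am /\ card_eq An Am.

Definition CSB_star : Prop :=
  forall X Y : V, card_eq_star X Y -> card_eq X Y.

End SetTheory.

(* Main.v *)
(** If [|X| =* |Y|] with both sets nonempty, the witnessing surjections form
    the sequence [X -> Y -> X -> Y -> ...], and a bijection between two
    consecutive terms is one between [X] and [Y] in one direction or the other.
    Inside a model of ZF the sequence has to be a set: the even numbers are
    obtained as the least set that contains [0] and is closed under [n |-> n+2],
    and the two sequences are then defined by cases with replacement. *)

Require Import Defs.
From Stdlib Require Import Classical.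

Section Model.

Variables (V : Type) (mem : V -> V -> Prop).
Hypothesis HZF : ZF mem.

Local Notation "x ∈ y" := (mem x y) (at level 70).

(* Each formula below is built so that [sat] of it is convertible to the
   predicate that it names; instances of the schemata are therefore
   used without any translation lemma. *)
Definition fIff (p q : formula) : formula := fAnd (fImp p q) (fImp q p).

Definition fNot (p : formula) : formula := fImp p fFalse.

Definition fEmpty (i : nat) : formula := fAll (fNot (fMem 0 (S i))).

Definition fUpair (z a b : nat) : formula :=
  fAll (fIff (fMem 0 (S z)) (fOr (fEq 0 (S a)) (fEq 0 (S b)))).

Definition fOpair (p a b : nat) : formula :=
  fAll (fIff (fMem 0 (S p))
    (fOr (fUpair 0 (S a) (S a)) (fUpair 0 (S a) (S b)))).

Definition fSucc (x s : nat) : formula :=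
  fAll (fIff (fMem 0 (S s)) (fOr (fMem 0 (S x)) (fEq 0 (S x)))).

Definition fInductive (w : nat) : formula :=
  fAnd (fEx (fAnd (fEmpty 0) (fMem 0 (S w))))
    (fAll (fImp (fMem 0 (S w))
       (fEx (fAnd (fSucc 1 0) (fMem 0 (S (S w))))))).

(** * Empty set, pairs and successors *)

Lemma is_empty_unique (x y : V) : is_empty mem x -> is_empty mem y -> x = y.
Proof.
  intros Hx Hy. apply (ZF_extensionality HZF). intro z. split; intro Hz.
  - destruct (Hx z Hz).
  - destruct (Hy z Hz).
Qed.

Lemma is_upair_unique (a b x y : V) :
  is_upair mem x a b -> is_upair mem y a b -> x = y.
Proof.
  intros Hx Hy. apply (ZF_extensionality HZF). intro z.
  rewrite (Hx z), (Hy z). reflexivity.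
Qed.

Lemma is_opair_unique (a b p q : V) :
  is_opair mem p a b -> is_opair mem q a b -> p = q.
Proof.
  intros Hp Hq. apply (ZF_extensionality HZF). intro z.
  rewrite (Hp z), (Hq z). reflexivity.
Qed.

Lemma is_opair_exists (a b : V) : exists p, is_opair mem p a b.
Proof.
  destruct (ZF_pairing HZF a a) as [s Hs].
  destruct (ZF_pairing HZF a b) as [d Hd].
  destruct (ZF_pairing HZF s d) as [p Hp].
  exists p. intro z. rewrite (Hp z). split.
  - intros [-> | ->]; [left | right]; assumption.
  - intros [H | H]; [left | right]; eapply is_upair_unique; eassumption.
Qed.

(** The singleton [{a}] equals [{a'}] or [{a', b'}], and both contain [a'], which gives [a = a'].
    After that, comparing the members of [p] puts [b] in [{a, b'}] and [b'] in [{a, b}], and every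
    combination forces [b = b']. *)
Lemma is_opair_inj (p a b a' b' : V) :
  is_opair mem p a b -> is_opair mem p a' b' -> a = a' /\ b = b'.
Proof.
  intros Hp Hp'.
  destruct (ZF_pairing HZF a a) as [s Hs].
  destruct (ZF_pairing HZF a b) as [d Hd].
  destruct (ZF_pairing HZF a' b') as [d' Hd'].
  assert (Ha : a = a').
  { assert (H : s ∈ p) by (apply Hp; now left).
    apply Hp' in H. destruct H as [H | H].
    - assert (E : a' ∈ s) by (apply H; now left).
      apply Hs in E. destruct E; congruence.
    - assert (E : a' ∈ s) by (apply H; now left).
      apply Hs in E. destruct E; congruence. }
  split; [exact Ha | subst a'].
  assert (Hb : b = a \/ b = b').
  { assert (H : d ∈ p) by (apply Hp; now right).
    assert (E : b ∈ d) by (apply Hd; now right).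
    apply Hp' in H. destruct H as [H | H]; apply H in E; tauto. }
  assert (Hb' : b' = a \/ b' = b).
  { assert (H : d' ∈ p) by (apply Hp'; now right).
    assert (E : b' ∈ d') by (apply Hd'; now right).
    apply Hp in H. destruct H as [H | H]; apply H in E; tauto. }
  destruct Hb, Hb'; congruence.
Qed.

Lemma is_succ_unique (x s t : V) :
  is_succ mem x s -> is_succ mem x t -> s = t.
Proof.
  intros Hs Ht. apply (ZF_extensionality HZF). intro z.
  rewrite (Hs z), (Ht z). reflexivity.
Qed.

Lemma is_succ_not_empty (x s : V) : is_succ mem x s -> ~ is_empty mem s.
Proof.
  intros Hs He. apply (He x), Hs. now right.
Qed.

(** Otherwise each element of [{x, y}] would meet [{x, y}], against foundation. *)
Lemma mem_asym (x y : V) : x ∈ y -> ~ y ∈ x.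
Proof.
  intros Hxy Hyx.
  destruct (ZF_pairing HZF x y) as [d Hd].
  destruct (ZF_foundation HZF d) as [m [Hm Hmin]].
  { exists x. apply Hd. now left. }
  apply Hmin. apply Hd in Hm. destruct Hm as [-> | ->].
  - exists y. split; [apply Hd; now right | assumption].
  - exists x. split; [apply Hd; now left | assumption].
Qed.

(** Both [x] and [y] lie in [s]; if they differed, each would be a member of the other. *)
Lemma is_succ_inj (x y s : V) : is_succ mem x s -> is_succ mem y s -> x = y.
Proof.
  intros Hx Hy.
  assert (H : x ∈ s) by (apply Hx; now right).
  apply Hy in H. destruct H as [H | H]; [| exact H].
  assert (H' : y ∈ s) by (apply Hy; now right).
  apply Hx in H'. destruct H' as [H' | H']; [| now symmetry].
  destruct (mem_asym _ _ H H').
Qed.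

(** * The natural numbers and the even numbers *)

Lemma omega_exists : exists w, is_omega mem w.
Proof.
  destruct (ZF_infinity HZF) as [v Hv].
  (* The intersection of all inductive sets, cut out of [v]. Index 1 is the candidate element and
     index 0 the inductive set; the environment is a filler. *)
  destruct (ZF_separation HZF
    (fAll (fImp (fInductive 0) (fMem 1 0))) (fun _ => v) v) as [w Hw].
  change (forall x, x ∈ w <-> x ∈ v /\ forall u, inductive mem u -> x ∈ u) in Hw.
  exists w. split; [split |].
  - destruct (proj1 Hv) as [o [Ho Hov]]. exists o. split; [exact Ho |].
    apply Hw. split; [exact Hov |]. intros u [[o' [Ho' Hu]] _].
    now rewrite (is_empty_unique _ _ Ho Ho').
  - intros x Hx. apply Hw in Hx. destruct Hx as [Hxv Hx].
    destruct (proj2 Hv x Hxv) as [s [Hs Hsv]].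
    exists s. split; [exact Hs |]. apply Hw. split; [exact Hsv |].
    intros u Hu. destruct (proj2 Hu x (Hx u Hu)) as [t [Ht Htu]].
    now rewrite (is_succ_unique _ _ _ Hs Ht).
  - intros u Hu z Hz. apply Hw in Hz. now apply Hz.
Qed.

(** Only the second successor [t] has to lie in [c]; the intermediate [s] is quantified because
    successor is a relation here. *)
Definition even_closed (c : V) : Prop :=
  (exists o, is_empty mem o /\ o ∈ c) /\
  (forall k, k ∈ c ->
     exists s, is_succ mem k s /\ exists t, is_succ mem s t /\ t ∈ c).

Definition fEvenClosed (c : nat) : formula :=
  fAnd (fEx (fAnd (fEmpty 0) (fMem 0 (S c))))
    (fAll (fImp (fMem 0 (S c))
       (fEx (fAnd (fSucc 1 0)
          (fEx (fAnd (fSucc 1 0) (fMem 0 (S (S (S c)))))))))).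

Definition is_evens (E : V) : Prop :=
  even_closed E /\ (forall c, even_closed c -> subset mem E c).

(** An inductive set is closed under two successor steps, so it bounds the intersection of all
    [even_closed] sets. *)
Lemma evens_exist : exists E, is_evens E.
Proof.
  destruct (ZF_infinity HZF) as [v Hv].
  assert (Hev : even_closed v).
  { split; [exact (proj1 Hv) |]. intros k Hk.
    destruct (proj2 Hv k Hk) as [s [Hs Hsv]].
    destruct (proj2 Hv s Hsv) as [t [Ht Htv]].
    exists s. split; [exact Hs |]. now exists t. }
  destruct (ZF_separation HZF
    (fAll (fImp (fEvenClosed 0) (fMem 1 0))) (fun _ => v) v) as [E HE].
  change (forall x, x ∈ E <-> x ∈ v /\ forall u, even_closed u -> x ∈ u) in HE.
  exists E. split; [split |].
  - destruct (proj1 Hv) as [o [Ho Hov]]. exists o. split; [exact Ho |].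
    apply HE. split; [exact Hov |]. intros u [[o' [Ho' Hu]] _].
    now rewrite (is_empty_unique _ _ Ho Ho').
  - intros x Hx. apply HE in Hx. destruct Hx as [Hxv Hx].
    destruct (proj2 Hev x Hxv) as [s [Hs [t [Ht Htv]]]].
    exists s. split; [exact Hs |]. exists t. split; [exact Ht |].
    apply HE. split; [exact Htv |].
    intros u Hu. destruct (proj2 Hu x (Hx u Hu)) as [s' [Hs' [t' [Ht' Htu]]]].
    rewrite (is_succ_unique _ _ _ Hs' Hs) in Ht'.
    now rewrite (is_succ_unique _ _ _ Ht Ht').
  - intros u Hu z Hz. apply HE in Hz. now apply Hz.
Qed.

(* Otherwise [E] without [t] would still be closed, against minimality. *)
Lemma evens_inv (E t : V) : is_evens E -> t ∈ E ->
  is_empty mem t \/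
  exists k s, k ∈ E /\ is_succ mem k s /\ is_succ mem s t.
Proof.
  intros [[[o [Ho HoE]] Hcl] Hmin] Ht.
  apply NNPP. intro Hn.
  destruct (ZF_separation HZF (fNot (fEq 0 1)) (fun _ => t) E) as [c Hc].
  change (forall x, x ∈ c <-> x ∈ E /\ x <> t) in Hc.
  assert (Hec : even_closed c).
  { split.
    - exists o. split; [exact Ho |]. apply Hc. split; [exact HoE |].
      intros ->. apply Hn. now left.
    - intros k Hk. apply Hc in Hk. destruct Hk as [Hk _].
      destruct (Hcl k Hk) as [s [Hs [t' [Ht' Ht'E]]]].
      exists s. split; [exact Hs |]. exists t'. split; [exact Ht' |].
      apply Hc. split; [exact Ht'E |].
      intros ->. apply Hn. right. now exists k, s. }
  apply (Hmin c Hec), Hc in Ht. now destruct Ht.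
Qed.

(** Induction over [E]: the elements of [E] with no successor in [E] form an [even_closed] set [c],
    so minimality makes [c] all of [E]. *)
Lemma evens_succ_notin (E n m : V) : is_evens E ->
  is_succ mem n m -> n ∈ E -> ~ m ∈ E.
Proof.
  intros HE Hnm Hn. pose proof HE as [[[o [Ho HoE]] Hcl] Hmin].
  destruct (ZF_separation HZF
    (fAll (fImp (fSucc 1 0) (fNot (fMem 0 2)))) (fun _ => E) E) as [c Hc].
  change (forall x, x ∈ c <->
    x ∈ E /\ forall y, is_succ mem x y -> ~ y ∈ E) in Hc.
  assert (Hec : even_closed c).
  { split.
    - exists o. split; [exact Ho |]. apply Hc. split; [exact HoE |].
      (* If [1] were in [E], it would be [k+2], and then [k+1] would be empty. *)
      intros y Hy HyE. destruct (evens_inv _ _ HE HyE) as [H | [k [s [_ [Hs Hsy]]]]].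
      + exact (is_succ_not_empty _ _ Hy H).
      + rewrite (is_succ_inj _ _ _ Hsy Hy) in Hs.
        exact (is_succ_not_empty _ _ Hs Ho).
    - intros x Hx. apply Hc in Hx. destruct Hx as [HxE Hx].
      destruct (Hcl x HxE) as [s [Hs [t [Ht HtE]]]].
      exists s. split; [exact Hs |]. exists t. split; [exact Ht |].
      apply Hc. split; [exact HtE |]. intros y Hy HyE.
      (* Here [y] is [x+3]; if it were in [E], inversion would put [x+1] in [E], against the
         induction hypothesis. *)
      destruct (evens_inv _ _ HE HyE) as [H | [k [s' [Hk [Hs' Hsy]]]]].
      + exact (is_succ_not_empty _ _ Hy H).
      + rewrite (is_succ_inj _ _ _ Hsy Hy) in Hs'.
        rewrite (is_succ_inj _ _ _ Hs' Ht) in Hk.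
        exact (Hx s Hs Hk). }
  apply (Hmin c Hec), Hc in Hn. now apply Hn.
Qed.

(** Induction over ω, with the disjunction itself as the separated property. *)
Lemma evens_or_succ (w E n m : V) : is_omega mem w -> is_evens E ->
  n ∈ w -> is_succ mem n m -> n ∈ E \/ m ∈ E.
Proof.
  intros [Hw Hwmin] [[[o [Ho HoE]] Hcl] _] Hn Hnm.
  destruct (ZF_separation HZF
    (fOr (fMem 0 1) (fAll (fImp (fSucc 1 0) (fMem 0 2)))) (fun _ => E) w)
    as [c Hc].
  change (forall x, x ∈ c <->
    x ∈ w /\ (x ∈ E \/ forall y, is_succ mem x y -> y ∈ E)) in Hc.
  assert (Hic : inductive mem c).
  { split.
    - exists o. split; [exact Ho |]. apply Hc. split; [| now left].
      destruct (proj1 Hw) as [o' [Ho' Hw']].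
      now rewrite (is_empty_unique _ _ Ho Ho').
    - intros x Hx. apply Hc in Hx. destruct Hx as [Hxw Hx].
      destruct (proj2 Hw x Hxw) as [s [Hs Hsw]].
      exists s. split; [exact Hs |]. apply Hc. split; [exact Hsw |].
      (* The disjuncts swap: if [x] is in [E], so is [x+2], the successor of [s]; otherwise [s]
         itself is in [E]. *)
      destruct Hx as [Hx | Hx]; [right | left; now apply Hx].
      intros y Hy. destruct (Hcl x Hx) as [s' [Hs' [t [Ht HtE]]]].
      rewrite (is_succ_unique _ _ _ Hs' Hs) in Ht.
      now rewrite (is_succ_unique _ _ _ Hy Ht). }
  apply (Hwmin c Hic), Hc in Hn. destruct Hn as [_ [H | H]].
  - now left.
  - right. now apply H.
Qed.

(** * Functions as sets of the model *)

Lemma function_by_cases (w E a b : V) : exists F,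
  is_function_on mem F w /\
  (forall n v, maps mem F n v ->
     n ∈ E /\ v = a \/ ~ n ∈ E /\ v = b).
Proof.
  destruct (ZF_replacement HZF
    (* Indices: 0 is the argument [n], 1 the pair [p], and 2, 3, 4 are the parameters [E], [a],
       [b]. *)
    (fOr (fAnd (fMem 0 2) (fOpair 1 0 3))
         (fAnd (fNot (fMem 0 2)) (fOpair 1 0 4)))
    (scons E (scons a (fun _ => b))) w) as [F HF].
  { intros n _.
    change (exists! p, n ∈ E /\ is_opair mem p n a \/
                       ~ n ∈ E /\ is_opair mem p n b).
    destruct (classic (n ∈ E)) as [HE | HE].
    - destruct (is_opair_exists n a) as [p Hp]. exists p. split; [now left |].
      intros q [[_ Hq] | [H _]]; [| contradiction].
      exact (is_opair_unique _ _ _ _ Hp Hq).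
    - destruct (is_opair_exists n b) as [p Hp]. exists p. split; [now right |].
      intros q [[H _] | [_ Hq]]; [contradiction |].
      exact (is_opair_unique _ _ _ _ Hp Hq). }
  change (forall p, p ∈ F <-> exists n, n ∈ w /\
    (n ∈ E /\ is_opair mem p n a \/ ~ n ∈ E /\ is_opair mem p n b)) in HF.
  assert (Hval : forall n v, maps mem F n v ->
     n ∈ E /\ v = a \/ ~ n ∈ E /\ v = b).
  { intros n v [p [Hp HpF]]. apply HF in HpF.
    destruct HpF as [k [_ [[Hk Hp'] | [Hk Hp']]]];
      destruct (is_opair_inj _ _ _ _ _ Hp Hp') as [-> ->]; tauto. }
  exists F. split; [split | exact Hval].
  - intros p Hp. apply HF in Hp.
    destruct Hp as [n [Hn [[_ Hp] | [_ Hp]]]]; [exists n, a | exists n, b]; tauto.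
  - intros n Hn. destruct (classic (n ∈ E)) as [HE | HE].
    + exists a. split.
      * destruct (is_opair_exists n a) as [p Hp]. exists p. split; [exact Hp |].
        apply HF. exists n. tauto.
      * intros v Hv. apply Hval in Hv. destruct Hv as [[_ ->] | [H _]]; tauto.
    + exists b. split.
      * destruct (is_opair_exists n b) as [p Hp]. exists p. split; [exact Hp |].
        apply HF. exists n. tauto.
      * intros v Hv. apply Hval in Hv. destruct Hv as [[H _] | [_ ->]]; tauto.
Qed.

(** Replacement along the swap of coordinates. The first clause records that [g] consists of pairs
    only, which [maps] cannot express and [is_function_on] demands. *)
Lemma converse_exists (f X Y : V) : is_function mem f X Y ->
  exists g, (forall q, q ∈ g -> exists a b, is_opair mem q b a /\ maps mem f a b) /\
            (forall a b, maps mem g b a <-> maps mem f a b).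
Proof.
  intros [[Hf _] _].
  destruct (ZF_replacement HZF
    (fEx (fEx (fAnd (fOpair 2 0 1) (fOpair 3 1 0)))) (fun _ => f) f) as [g Hg].
  { intros p Hp.
    change (exists! q, exists b a, is_opair mem p a b /\ is_opair mem q b a).
    destruct (Hf p Hp) as [a [b [_ Hab]]].
    destruct (is_opair_exists b a) as [q Hq].
    exists q. split; [now exists b, a |].
    intros q' [b' [a' [Hp' Hq']]].
    destruct (is_opair_inj _ _ _ _ _ Hab Hp') as [<- <-].
    exact (is_opair_unique _ _ _ _ Hq Hq'). }
  change (forall q, q ∈ g <-> exists p, p ∈ f /\
    exists b a, is_opair mem p a b /\ is_opair mem q b a) in Hg.
  exists g. split.
  - intros q Hq. apply Hg in Hq. destruct Hq as [p [Hp [b [a [Hpab Hq]]]]].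
    exists a, b. split; [exact Hq |]. now exists p.
  - intros a b. split.
    + intros [q [Hq Hqg]]. apply Hg in Hqg.
      destruct Hqg as [p [Hp [b' [a' [Hpab Hq']]]]].
      destruct (is_opair_inj _ _ _ _ _ Hq Hq') as [-> ->]. now exists p.
    + intros [p [Hp Hpf]]. destruct (is_opair_exists b a) as [q Hq].
      exists q. split; [exact Hq |]. apply Hg. exists p. split; [exact Hpf |].
      now exists b, a.
Qed.

Lemma maps_dom (f X a b : V) : is_function_on mem f X -> maps mem f a b -> a ∈ X.
Proof.
  intros [Hf _] [p [Hp Hpf]]. destruct (Hf p Hpf) as [a' [b' [Ha Hp']]].
  destruct (is_opair_inj _ _ _ _ _ Hp Hp') as [-> _]. exact Ha.
Qed.

Lemma maps_fun (f X a b b' : V) : is_function_on mem f X ->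
  maps mem f a b -> maps mem f a b' -> b = b'.
Proof.
  intros Hf Hb Hb'.
  destruct (proj2 Hf a (maps_dom _ _ _ _ Hf Hb)) as [c [_ Hc]].
  rewrite <- (Hc b Hb). exact (Hc b' Hb').
Qed.

(** * Bijections and the alternating sequence *)

(** For the converse [g], single-valuedness comes from injectivity of [f], and injectivity from [f]
    being a function. *)
Lemma card_eq_sym (X Y : V) : card_eq mem X Y -> card_eq mem Y X.
Proof.
  intros [f [[Hf Hinj] [_ Hsurj]]]. pose proof Hf as [Hfon Hran].
  destruct (converse_exists _ _ _ Hf) as [g [Hpairs Hg]].
  assert (Hgf : is_function mem g Y X).
  { split; [split |].
    - intros q Hq. destruct (Hpairs q Hq) as [a [b [Hqb Hab]]].
      exists b, a. split; [exact (Hran _ _ Hab) | exact Hqb].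
    - intros b Hb. destruct (Hsurj b Hb) as [a [_ Hab]].
      exists a. split; [now apply Hg |].
      intros a' Ha'. apply Hg in Ha'. exact (Hinj _ _ _ Hab Ha').
    - intros b a Hba. apply Hg in Hba. exact (maps_dom _ _ _ _ Hfon Hba). }
  exists g. split; split; try exact Hgf.
  - intros b b' a Hb Hb'. apply Hg in Hb, Hb'.
    exact (maps_fun _ _ _ _ _ Hfon Hb Hb').
  - intros a Ha. destruct (proj2 Hfon a Ha) as [b [Hab _]].
    exists b. split; [exact (Hran _ _ Hab) | now apply Hg].
Qed.

Lemma card_eq_empty (X Y : V) : is_empty mem X -> is_empty mem Y -> card_eq mem X Y.
Proof.
  intros HX HY. rewrite (is_empty_unique _ _ HY HX).
  assert (Hm : forall a b, ~ maps mem X a b) by (intros a b [p [_ H]]; exact (HX p H)).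
  assert (Hf : is_function mem X X X).
  { split; [split |].
    - intros p Hp. destruct (HX p Hp).
    - intros a Ha. destruct (HX a Ha).
    - intros a b H. destruct (Hm _ _ H). }
  (* The empty set [X] serves as the empty function. *)
  exists X. split; split; try exact Hf.
  - intros a a' b H. destruct (Hm _ _ H).
  - intros y Hy. destruct (HX y Hy).
Qed.

Lemma surjection_from_empty (f X Y : V) :
  is_surjection mem f X Y -> is_empty mem X -> is_empty mem Y.
Proof.
  intros [_ Hs] HX y Hy. destruct (Hs y Hy) as [x [Hx _]]. exact (HX x Hx).
Qed.

Lemma card_eq_of_surjections (f g X Y : V) : WF_b4_s mem ->
  is_surjection mem f X Y -> is_surjection mem g Y X -> card_eq mem X Y.
Proof.
  intros HWF Hf Hg.
  destruct omega_exists as [w Hw].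
  destruct evens_exist as [E HE].
  destruct (function_by_cases w E X Y) as [A [HA HAv]].
  destruct (function_by_cases w E f g) as [F [HF HFv]].
  destruct (HWF w A F Hw HA HF) as [n [m [An [Am [Hn [Hnm [HAn [HAm Heq]]]]]]]].
  - intros i j Ai Aj fi Hi Hij HAi HAj Hfi.
    pose proof (evens_succ_notin _ _ _ HE Hij) as Hno.
    pose proof (evens_or_succ _ _ _ _ Hw HE Hi Hij) as Hor.
    (* Exactly one of [i], [j] is in [E], so two of the eight cases survive: [f] from [X] to [Y] for
       even [i], [g] from [Y] to [X] for odd [i]. *)
    destruct (HAv _ _ HAi) as [[Hi1 ->] | [Hi1 ->]];
    destruct (HFv _ _ Hfi) as [[Hi2 ->] | [Hi2 ->]];
    destruct (HAv _ _ HAj) as [[Hi3 ->] | [Hi3 ->]]; tauto.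
  - pose proof (evens_succ_notin _ _ _ HE Hnm) as Hno.
    pose proof (evens_or_succ _ _ _ _ Hw HE Hn Hnm) as Hor.
    destruct (HAv _ _ HAn) as [[Hi1 ->] | [Hi1 ->]];
    destruct (HAv _ _ HAm) as [[Hi3 ->] | [Hi3 ->]]; try tauto.
    (* The case left over is odd [n], where the bijection runs from [Y] to [X]. *)
    now apply card_eq_sym.
Qed.

End Model.

Theorem theorem8p1 (V : Type) (mem : V -> V -> Prop) (HZF : ZF mem) :
  WF_b4_s mem -> CSB_star mem.
Proof.
  intros HWF X Y [[HX | [g Hg]] [HY | [f Hf]]].
  - now apply card_eq_empty.
  (* When one set is empty, the surjection defined on it makes the other empty too; likewise in the
     next case. *)
  - apply card_eq_empty; trivial. eapply surjection_from_empty; eassumption.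
  - apply card_eq_empty; trivial. eapply surjection_from_empty; eassumption.
  - eapply card_eq_of_surjections; eassumption.
Qed.
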